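(* Let $(V,\mu)$ and $(E,\tau)$ be positive measure spaces, $K:V\times E\to\mathbb{R}$ a $(\mu\times\tau)$-measurable function, $wt:E\to\mathbb{R}$ a $\tau$-measurable function, and $\varphi:(0,\infty)\to\mathbb{R}$ a function such that $f(t)=t\varphi(t)$ is convex on $(0,\infty)$. Suppose that: (i) $0<\mu(V)<\infty$; (ii) $0<s:=\int_E wt\,d\tau<\infty$; (iii) $\int_{V\times E}|K(v,e)|\,|wt(e)|\,d(\mu\times\tau)<\infty$; (iv) for some real number $c$, $\int_V K(v,e)\,d\mu(v)=c$ for $\tau$-almost all $e\in E$; (v) for $\mu$-almost all $v\in V$, $\delta(v):=\int_E K(v,e)\,wt(e)\,d\tau(e)\in(0,\infty)$; (vi) $\int_{V\times E}|\varphi(\delta(v))|\,|K(v,e)|\,|wt(e)|\,d(\mu\times\tau)<\infty$. Let $\bar\delta=\frac{1}{\mu(V)}\int_V\delta\,d\mu$. Suppose in addition that: (a) $f$ is twice continuously differentiable on $(0,\infty)$; (b) there exist numbers $0<m<M<\infty$ such that $m\le\delta(v)\le M$ for $\mu$-a.e. $v\in V$; (c) there is a constant $\alpha$ such that $f''(t)\ge\alpha>0$ for all $t\in[m,M]$. Then $$\frac1s\int_{V\times E}\varphi(\delta(v))\,K(v,e)\,wt(e)\,d(\mu\times\tau)\;\ge\;c\,\varphi(\bar\delta)+\frac{\alpha}{2s}\int_V(\delta(v)-\bar\delta)^2\,d\mu(v).$$ In particular, equality holds if and only if $\delta(v)=\bar\delta$ for $\mu$-a.e. $v\in V$.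
   Context: $\mu\times\tau$ denotes the product measure on $V\times E$.
   Formalization: The equality clause is proved for the inequality without the quadratic term, (1/s)∫φ(δ)K wt ≥ cφ(δ̄): equality there iff δ=δ̄ a.e. For the displayed inequality the ''only if'' part is false, e.g. when φ(t)=αt/2, where equality always holds. *)

(* Defs.v *)
From HB Require Import structures.
From mathcomp Require Import all_boot all_order all_algebra.
From mathcomp Require Import all_classical all_reals all_analysis.

Set Implicit Arguments.
Unset Strict Implicit.
Unset Printing Implicit Defensive.

Import Order.TTheory GRing.Theory Num.Theory.
Import numFieldNormedType.Exports.

Local Open Scope classical_set_scope.
Local Open Scope ring_scope.
Local Open Scope ereal_scope.

(* The library's [mu \x tau] has the expected values on rectangles only for
   sigma-finite [tau] (product_measure1E).  For arbitrary measures there may be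
   several measures with these values; a theorem about every [rho] with
   [is_product_measure mu tau rho] covers each of them. *)
Definition is_product_measure d1 d2 (V : measurableType d1)
    (E : measurableType d2) (R : realType)
    (mu : {measure set V -> \bar R}) (tau : {measure set E -> \bar R})
    (rho : {measure set (V * E) -> \bar R}) : Prop :=
  forall (A : set V) (B : set E), measurable A -> measurable B ->
    rho (A `*` B) = mu A * tau B.

(* [D] is meant to be open, so that the derivatives, which are taken in [R],
   only depend on [f] on [D]. *)
Definition twice_continuously_differentiable (R : realType) (D : set R)
    (f : R -> R) : Prop :=
  forall t : R, D t ->
    [/\ derivable f t 1%R, derivable (f^`())%classic t 1%R
      & {for t, continuous (f^`(2))%classic}].

(* Main.v *)
Require Import Defs.
From HB Require Import structures.
From mathcomp Require Import all_boot all_order all_algebra.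
From mathcomp Require Import all_classical all_reals all_analysis.
From mathcomp Require Import measurable_realfun.
From mathcomp Require Import ring lra.

Set Implicit Arguments.
Unset Strict Implicit.
Unset Printing Implicit Defensive.

Import Order.TTheory GRing.Theory Num.Theory.
Import numFieldNormedType.Exports.

Local Open Scope classical_set_scope.
Local Open Scope ring_scope.

(* Since wt is tau-integrable, D = {wt <> 0} is sigma-finite for tau.  Both
   integrands vanish off V x D, and on V x D uniqueness of sigma-finite product
   measures identifies rho with the product of mu and the restriction of tau.
   Fubini then applies without sigma-finiteness of tau: with f t = t * phi t,
   the left-hand integral is the integral of f (delta), and the integral of
   delta is c * s.
   What remains is Jensen's inequality for f and the finite measure mu, with
   the linear lower bound at the mean improved by alpha / 2 * (t - dbar) ^ 2. *)

(** * Strong convexity from a lower bound on the second derivative *)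

(** Subtracting the parabola [alpha / 2 * (x - d) ^+ 2] from [f] leaves a function [h] whose second
    derivative is nonnegative on [m, M]. So [h'] is nondecreasing there, and the mean value theorem
    puts [h] above its tangent at [d], where [h] and [f] agree to first order. *)
Lemma quadratic_lower_bound (R : realType) (f : R -> R) (m M alpha d t : R) :
  (forall x, m <= x <= M ->
     [/\ derivable f x 1, derivable (f^`())%classic x 1 & alpha <= (f^`(2))%classic x]) ->
  m <= d <= M -> m <= t <= M ->
  f d + (f^`())%classic d * (t - d) + alpha / 2 * (t - d) ^+ 2 <= f t.
Proof.
move=> fP dmM tmM.
pose h x := f x - alpha / 2 * (x - d) ^+ 2.
pose h' x := (f^`())%classic x - alpha * (x - d).
have dh x : m <= x <= M -> is_derive x 1 h (h' x).
  move=> /fP[fx _ _].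
  have fx' : is_derive x 1 f ((f^`())%classic x) by rewrite derive1E; exact: DeriveDef.
  rewrite /h /h'; apply: is_derive_eq.
  by rewrite /GRing.scale/=; field.
have dh' x : m <= x <= M -> is_derive x 1 h' ((f^`(2))%classic x - alpha).
  move=> /fP[_ fx _].
  have fx' : is_derive x 1 (f^`())%classic ((f^`(2))%classic x).
    by rewrite /= derive1E; exact: DeriveDef.
  rewrite /h'; apply: is_derive_eq.
  by rewrite /GRing.scale/=; ring.
have sub x y z : m <= x <= M -> m <= y <= M -> z \in `[x, y] -> m <= z <= M.
  by rewrite in_itv/= => ? ? ?; lra.
have mono x y : m <= x <= M -> m <= y <= M -> x <= y -> h' x <= h' y.
  move=> xP yP xy.
  have [] := @MVT_segment _ h' (fun z => (f^`(2))%classic z - alpha) x y xy.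
  - by move=> z /subset_itv_oo_cc /(sub _ _ _ xP yP)/dh'.
  - apply/continuous_in_subspaceT => z /set_mem/= /(sub _ _ _ xP yP) zP.
    apply: differentiable_continuous; apply/derivable1_diffP.
    by have := dh' _ zP; apply: @ex_derive.
  move=> z /(sub _ _ _ xP yP)/fP[_ _ ?] e.
  by rewrite -subr_ge0 e mulr_ge0// subr_ge0.
have ddh x y : m <= x <= M -> m <= y <= M -> x <= y ->
    exists2 z, z \in `[x, y] & h y - h x = h' z * (y - x).
  move=> xP yP xy; apply: MVT_segment => //.
  - by move=> z /subset_itv_oo_cc /(sub _ _ _ xP yP)/dh.
  - apply/continuous_in_subspaceT => z /set_mem/= /(sub _ _ _ xP yP) zP.
    apply: differentiable_continuous; apply/derivable1_diffP.
    by have := dh _ zP; apply: @ex_derive.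
have hd : h d = f d by rewrite /h subrr expr0n/= mulr0 subr0.
have h'd : h' d = (f^`())%classic d by rewrite /h' subrr mulr0 subr0.
suff : h d + h' d * (t - d) <= h t by rewrite hd h'd /h; lra.
have [dt|/ltW td] := leP d t.
- have [z zP e] := ddh _ _ dmM tmM dt.
  have := mono _ _ dmM (sub _ _ _ dmM tmM zP).
  move: zP; rewrite in_itv/= => /andP[dz zt] /(_ dz) h'z.
  rewrite -lerBrDl e; apply: ler_wpM2r => //; lra.
- have [z zP e] := ddh _ _ tmM dmM td.
  have := mono _ _ (sub _ _ _ tmM dmM zP) dmM.
  move: zP; rewrite in_itv/= => /andP[tz zd] /(_ zd) h'z.
  have : h' z * (d - t) <= h' d * (d - t) by apply: ler_wpM2r => //; lra.
  by rewrite -e; lra.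
Qed.

(** * Almost everywhere comparison of integrals *)

Section ae_integral.
Local Open Scope ereal_scope.
Import HBNNSimple.

(** A simple function below [f], once set to 0 on the exceptional null set, lies below [g]
    everywhere and keeps its integral; so the supremum defining the left side is at most the one on
    the right. *)
Lemma ge0_ae_le_integralT d (T : measurableType d) (R : realType)
  (mu : {measure set T -> \bar R}) (f g : T -> \bar R) :
  (forall x, 0 <= f x) -> (forall x, 0 <= g x) ->
  {ae mu, forall x, f x <= g x} ->
  \int[mu]_x f x <= \int[mu]_x g x.
Proof.
move=> f0 g0 [N [mN N0 fgN]].
rewrite !ge0_integralTE//; apply: ge_ereal_sup => _ [h /= hf <-].
apply: ereal_sup_ubound.
have mNC : measurable (~` N) by exact: measurableC.
exists (proj_nnsfun h mNC).
  move=> x; rewrite -(mrestrict h mNC) patchE; case: ifPn => [xN|_]; last exact: g0.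
  apply: le_trans (hf x) _.
  by apply: contrapT => fg; move: xN; rewrite inE; apply; apply: fgN.
rewrite -!integralT_nnsfun; apply: ae_eq_integral => //.
- exact/measurable_EFinP/measurable_funP.
- exact/measurable_EFinP/measurable_funP.
exists N; split => // x /= /not_implyP[_]; apply: contra_notP => xN.
by have /(congr1 (@^~ x))/= <- := mrestrict h mNC; rewrite patchE mem_set.
Qed.

(* Unlike [ae_eq_integral], no measurability: both sides are suprema over
   simple functions, which can be set to [0] on the null set. *)
Lemma ae_eq_integralT d (T : measurableType d) (R : realType)
  (mu : {measure set T -> \bar R}) (f g : T -> \bar R) :
  {ae mu, forall x, f x = g x} -> \int[mu]_x f x = \int[mu]_x g x.
Proof.
move=> fg; rewrite integralE [RHS]integralE.
have gf : {ae mu, forall x, g x = f x} by apply: filterS fg.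
congr (_ - _); apply/eqP; rewrite eq_le.
  by apply/andP; split; apply: ge0_ae_le_integralT => //;
    [apply: filterS fg|apply: filterS gf] => x /=; rewrite !funeposE => ->.
by apply/andP; split; apply: ge0_ae_le_integralT => //;
    [apply: filterS fg|apply: filterS gf] => x /=; rewrite !funenegE => ->.
Qed.

End ae_integral.

(** * Restricting a measure to a sigma-finite set *)

Section restriction.
Local Open Scope ereal_scope.

Lemma integral_mrestr d (T : measurableType d) (R : realType)
  (mu : {measure set T -> \bar R}) (D : set T) (mD : measurable D) (f : T -> \bar R) :
  (forall x, ~ D x -> f x = 0) ->
  \int[mrestr mu mD]_x f x = \int[mu]_x f x.
Proof.
move=> f0; have fD : f = f \_ D.
  by apply/funext => x; rewrite patchE; case: ifPn => // /negP xD;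
    apply: f0; apply: contra_not xD => /mem_set.
rewrite fD -!integral_mkcond; apply: eq_measure_integral => A mA AD /=.
by rewrite /mrestr setIidl.
Qed.

(** An alias of [mu] indexed by the proof [smu], so that a sigma-finite structure can be attached to
    it and the product measure formed. *)
Definition sigma_finite_copy d (T : measurableType d) (R : realType)
  (mu : {measure set T -> \bar R}) (smu : sigma_finite setT mu) : set T -> \bar R := mu.
HB.instance Definition _ d (T : measurableType d) (R : realType)
  (mu : {measure set T -> \bar R}) (smu : sigma_finite setT mu) :=
  Measure.on (sigma_finite_copy smu).
HB.instance Definition _ d (T : measurableType d) (R : realType)
  (mu : {measure set T -> \bar R}) (smu : sigma_finite setT mu) :=
  Measure_isSigmaFinite.Build _ _ _ (sigma_finite_copy smu) smu.

(** The complement of [D] is null for the restriction, so joining it to every set of a cover of [D]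
    covers the whole space at no cost. *)
Lemma sigma_finite_mrestr d (T : measurableType d) (R : realType)
  (mu : {measure set T -> \bar R}) (D : set T) (mD : measurable D) :
  sigma_finite D mu -> sigma_finite setT (mrestr mu mD).
Proof.
move=> [F DF Foo]; exists (fun n => F n `|` ~` D).
  apply/seteqP; split => // x _.
  have [Dx|Dx] := pselect (D x); last by exists 0%N => //; right.
  by move: (Dx); rewrite {1}DF => -[n _ ?]; exists n => //; left.
move=> n; have [mFn Fn] := Foo n; split.
  by apply: measurableU => //; exact: measurableC.
rewrite /mrestr setIUl setICl setU0 setIidl// {1}DF; exact: bigcup_sup.
Qed.

End restriction.

(** * Fubini for integrands supported over a sigma-finite set *)

Section product_integral.
Local Open Scope ereal_scope.

Lemma fubini_sigma_finite_support (R : realType) (d1 d2 : measure_display)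
    (V : measurableType d1) (E : measurableType d2)
    (mu : {measure set V -> \bar R}) (tau : {measure set E -> \bar R})
    (rho : {measure set (V * E) -> \bar R}) (D : set E) (F : V * E -> \bar R) :
  is_product_measure mu tau rho -> sigma_finite setT mu ->
  measurable D -> sigma_finite D tau ->
  (forall p, ~ D p.2 -> F p = 0) -> rho.-integrable setT F ->
  [/\ mu.-integrable setT (fun v => \int[tau]_e F (v, e)),
      \int[rho]_p F p = \int[mu]_v \int[tau]_e F (v, e) &
      \int[mu]_v \int[tau]_e F (v, e) = \int[tau]_e \int[mu]_v F (v, e)].
Proof.
move=> rhoE smu mD sD F0 /integrableP[mF iF].
pose mu' := sigma_finite_copy smu.
pose tau' := sigma_finite_copy (sigma_finite_mrestr mD sD).
have mVD : measurable ([set: V] `*` D) by exact: measurableX.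
(* On rectangles, [rho] restricted to [[set: V]]*[D] has the values of the product of [mu'] and
   [tau'], both sigma-finite, so the two measures coincide. *)
have intE G : (forall p, ~ D p.2 -> G p = 0) ->
    \int[rho]_p G p = \int[mu' \x tau']_p G p.
  move=> G0; rewrite -(integral_mrestr rho mVD); last first.
    by move=> p VDp; apply: G0 => Dp; exact: VDp.
  apply/esym/eq_measure_integral => A mA _.
  apply: (@product_measure_unique _ _ _ _ _ mu' tau' (mrestr rho mVD)) => //.
  move=> B C mB mC; rewrite /= /mrestr -setXI setIT.
  by rewrite rhoE//; exact: measurableI.
have itau' : (fun v => \int[tau]_e F (v, e)) = fubini_F tau' F.
  apply/funext => v; rewrite /fubini_F /tau' -(integral_mrestr tau mD)//.
  by move=> e De; exact: F0.
have imF : (mu' \x tau').-integrable setT F.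
  apply/integrableP; split => //; rewrite -intE// => p Dp.
  by rewrite F0// abse0.
split.
- by rewrite itau'; exact: (@integrable_fubini_F _ _ _ _ _ mu' tau').
- by rewrite itau' intE// -(@integral12_prod_meas1 _ _ _ _ _ mu' tau').
(* Fubini leaves an outer integral against [tau']; its integrand vanishes off [D], so [tau] can be
   put back. *)
- rewrite itau' -/(fubini_F tau' F) (@Fubini _ _ _ _ _ mu' tau')//.
  apply: (integral_mrestr tau mD) => e De.
  by under eq_integral do rewrite F0//; exact: integral0.
Qed.

Lemma fin_num_integrable d (T : measurableType d) (R : realType)
    (mu : {measure set T -> \bar R}) (f : T -> \bar R) :
  measurable_fun setT f -> \int[mu]_x f x \is a fin_num ->
  mu.-integrable setT f.
Proof.
move=> mf foo; apply/integrableP; split => //.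
by apply/abse_integralP => //; rewrite -fin_num_abs.
Qed.

(** The set is exhausted by the level sets where [|f|] is at least [n.+1%:R^-1], and each of these
    has finite measure by Markov's inequality. *)
Lemma sigma_finite_neq0 d (T : measurableType d) (R : realType)
    (mu : {measure set T -> \bar R}) (f : T -> R) :
  mu.-integrable setT (EFin \o f) ->
  measurable [set x | f x != 0%R] /\ sigma_finite [set x | f x != 0%R] mu.
Proof.
move=> /integrableP[/measurable_EFinP mf foo]; split.
  rewrite (_ : mkset _ = setT `&` f @^-1` (~` [set 0%R])).
    by apply: mf => //; exact: measurableC.
  by rewrite setTI; apply/seteqP; split=> x /= /eqP.
pose F n := [set x | (n.+1%:R^-1)%:E <= `|(EFin \o f) x|].
have mF n : measurable (F n).
  rewrite -[X in measurable X]setTI.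
  apply: emeasurable_fun_c_infty => //; apply: measurableT_comp => //.
  exact/measurable_EFinP.
exists F.
  apply/seteqP; split=> x /=.
    rewrite -normr_gt0 => fx0.
    exists (Num.truncn `|f x|^-1) => //=.
    rewrite /F /= lee_fin invf_ple ?posrE//.
    exact/ltW/Num.Theory.truncnS_gt.
  move=> [n _]; rewrite /F /= lee_fin; apply: contraTneq => ->.
  by rewrite normr0 -ltNge invr_gt0.
move=> n; split => //.
have n0 : (0 < n.+1%:R^-1 :> R)%R by rewrite invr_gt0.
have mf' : measurable_fun setT (EFin \o f) by exact/measurable_EFinP.
have := @le_integral_comp_abse _ _ _ mu setT measurableT (EFin \o f) _ id
  (@measurable_id _ _ _) (fun _ => id) (fun _ _ _ _ => id) mf' n0.
rewrite setTI => /le_lt_trans /(_ foo).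
have := measure_ge0 mu (F n); rewrite -/(F n).
case: (mu (F n)) => [r _ _|_|//]; first exact: ltry.
by rewrite gt0_muley// lte_fin.
Qed.

End product_integral.

(** * Jensen's inequality on a finite measure space, with a quadratic remainder *)

Lemma integrable_bounded d (T : measurableType d) (R : realType)
    (mu : {measure set T -> \bar R}) (h : T -> R) (C : R) :
  (mu setT < +oo)%E -> measurable_fun setT h -> (forall x, `|h x| <= C) ->
  mu.-integrable setT (EFin \o h).
Proof.
move=> muoo mh hC; apply: measurable_bounded_integrable => //.
exists C; split; first exact: num_real.
by move=> x Cx y _; apply: le_trans (hC y) (ltW Cx).
Qed.

Lemma ae_eq_Rintegral d (T : measurableType d) (R : realType)
    (mu : {measure set T -> \bar R}) (f g : T -> R) :
  {ae mu, forall x, f x = g x} -> \int[mu]_x f x = \int[mu]_x g x.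
Proof.
move=> fg; rewrite /Rintegral; congr fine; apply: ae_eq_integralT.
by apply: filterS fg => x ->.
Qed.

Section jensen.
Context d (T : measurableType d) (R : realType) (mu : {measure set T -> \bar R}).
Variables (Y : T -> R) (m M : R).
Hypotheses (mu_gt0 : (0 < mu setT)%E) (mu_lty : (mu setT < +oo)%E).
Hypotheses (mY : measurable_fun setT Y) (YmM : forall x, m <= Y x <= M).
Let S := fine (mu setT).
Let mean := S^-1 * \int[mu]_x Y x.

Let S_gt0 : 0 < S.
Proof. by rewrite /S fine_gt0// mu_gt0. Qed.

Lemma integrable_itv : mu.-integrable setT (EFin \o Y).
Proof.
apply: (integrable_bounded (C := `|m| + `|M|)) => // x.
have := YmM x; have := ler_norm M; have := ler_norm (- m).
by rewrite normrN ler_norml => ? ? ?; have := normr_ge0 m; have := normr_ge0 M; lra.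
Qed.

Let integrable_cst k : mu.-integrable setT (EFin \o (fun=> k)).
Proof. exact: (integrable_bounded (C := `|k|)). Qed.

Let meanE : \int[mu]_x Y x = S * mean.
Proof. by rewrite /mean mulrA mulfV ?mul1r// gt_eqF. Qed.

Lemma mean_itv : m <= mean <= M.
Proof.
rewrite -(ler_pM2l S_gt0) -[_ <= M](ler_pM2l S_gt0) -meanE.
apply/andP; split.
  rewrite mulrC -Rintegral_cst//; apply: le_Rintegral => //.
    exact: integrable_itv.
  by move=> x _; have /andP[] := YmM x.
rewrite mulrC -Rintegral_cst//; apply: le_Rintegral => //.
  exact: integrable_itv.
by move=> x _; have /andP[] := YmM x.
Qed.

Lemma integrable_sqr_dist : mu.-integrable setT (EFin \o (fun x => (Y x - mean) ^+ 2)).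
Proof.
apply: (integrable_bounded (C := (M - m) ^+ 2)) => //.
  apply: measurable_funX; exact: measurable_funB.
move=> x; rewrite ger0_norm ?sqr_ge0// -subr_ge0 subr_sqr.
have := mean_itv; have := YmM x => /andP[? ?] /andP[? ?].
by apply: mulr_ge0; lra.
Qed.

(** The pointwise bound is integrated at [t = Y x]. The slope [b] disappears from the result; it
    will be the derivative of [g] at the mean. *)
Lemma jensen_quadratic (g : R -> R) (a b : R) :
  mu.-integrable setT (EFin \o (g \o Y)) ->
  (forall t, m <= t <= M -> g mean + b * (t - mean) + a * (t - mean) ^+ 2 <= g t) ->
  S * g mean + a * \int[mu]_x (Y x - mean) ^+ 2 <= \int[mu]_x g (Y x).
Proof.
move=> ig gP.
have iY := integrable_itv; have iQ := integrable_sqr_dist.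
have iD : mu.-integrable setT (EFin \o (fun x => Y x - mean)).
  have := integrableB measurableT iY (integrable_cst mean).
  by apply: eq_integrable => // x _; rewrite /= EFinB.
have ibD : mu.-integrable setT (EFin \o (fun x => b * (Y x - mean))).
  have := integrableZl measurableT b iD.
  by apply: eq_integrable => // x _; rewrite /= EFinM.
have iaQ : mu.-integrable setT (EFin \o (fun x => a * (Y x - mean) ^+ 2)).
  have := integrableZl measurableT a iQ.
  by apply: eq_integrable => // x _; rewrite /= EFinM.
have iL : mu.-integrable setT (EFin \o (fun x => g mean + b * (Y x - mean))).
  have := integrableD measurableT (integrable_cst (g mean)) ibD.
  by apply: eq_integrable => // x _; rewrite /= EFinD.
have iT : mu.-integrable setT
    (EFin \o (fun x => g mean + b * (Y x - mean) + a * (Y x - mean) ^+ 2)).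
  have := integrableD measurableT iL iaQ.
  by apply: eq_integrable => // x _; rewrite /= EFinD.
apply: le_trans (le_Rintegral measurableT iT ig (fun x _ => gP _ (YmM x))).
(* the linear term integrates to zero around the mean *)
rewrite RintegralD// RintegralD// !RintegralZl// RintegralB// !Rintegral_cst// meanE.
by rewrite -/S [S * mean]mulrC subrr mulr0 addr0 mulrC.
Qed.

(** A nonnegative function with zero integral vanishes almost everywhere. *)
Lemma ae_eq_mean :
  \int[mu]_x (Y x - mean) ^+ 2 <= 0 -> {ae mu, forall x, Y x = mean}.
Proof.
move=> Q0; have iQ := integrable_sqr_dist.
have mQ := measurable_int _ iQ.
have /(ae_eq_integral_abs mu measurableT mQ) :
    (\int[mu]_x `|(EFin \o (fun x => (Y x - mean) ^+ 2)%R) x| = 0)%E.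
  under eq_integral do rewrite /= ger0_norm ?sqr_ge0//.
  rewrite -[LHS]fineK; last exact: integrable_fin_num iQ.
  congr EFin; apply/eqP; rewrite eq_le Q0/=.
  by apply: Rintegral_ge0 => x _; exact: sqr_ge0.
apply: filterS => x /= /(_ I) [] /eqP.
by rewrite sqrf_eq0 subr_eq0 => /eqP.
Qed.

End jensen.

(** * Null sets of the product, and the weighted inequality *)

(** The cylinder over a null set [N] has measure [0 * tau setT], which is 0 even when [tau setT] is
    infinite. *)
Lemma ae_fst_product d1 d2 (V : measurableType d1) (E : measurableType d2)
    (R : realType) (mu : {measure set V -> \bar R}) (tau : {measure set E -> \bar R})
    (rho : {measure set (V * E) -> \bar R}) (P : V -> Prop) :
  is_product_measure mu tau rho ->
  {ae mu, forall v, P v} -> {ae rho, forall p, P p.1}.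
Proof.
move=> rhoE [N [mN N0 PN]]; exists (N `*` setT); split.
- exact: measurableX.
- by rewrite rhoE// N0 mul0e.
- by move=> p /= /PN.
Qed.

(* - Only the values of [phi] on ]0, +oo[ are constrained; [phi (fine (delta v))]
     is meaningful for mu-almost every v.
   - The library's Lebesgue integral of a measurable function whose positive and
     negative parts both have infinite integral is [-oo]; hence an integral
     that is finite, or greater than 0, is a genuine one.
   - The equality discussed in the last clause is the one in the Jensen-type
     inequality without the quadratic term: the inequality with
     the quadratic term is an equality for every delta when phi t = alpha * t / 2. *)
Theorem theorem3p1 (R : realType) (d1 d2 : measure_display)
    (V : measurableType d1) (E : measurableType d2)
    (mu : {measure set V -> \bar R}) (tau : {measure set E -> \bar R})
    (rho : {measure set (V * E) -> \bar R})
    (K : V * E -> R) (wt : E -> R) (phi : R -> R) (c m M alpha : R) :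
  let f : R -> R := fun t => t * phi t in
  let s : R := \int[tau]_e wt e in
  let delta : V -> \bar R :=
    fun v => (\int[tau]_e (K (v, e) * wt e)%:E)%E in
  let dbar : R := (fine (mu [set: V]))^-1 * \int[mu]_v fine (delta v) in
  is_product_measure mu tau rho ->
  measurable_fun [set: V * E] K ->
  measurable_fun [set: E] wt ->
  convex_function (`]0, +oo[%classic : set R) f ->
  (0 < mu [set: V] < +oo)%E ->
  (0 < \int[tau]_e (wt e)%:E < +oo)%E ->
  (\int[rho]_p (`|K p| * `|wt p.2|)%:E < +oo)%E ->
  {ae tau, forall e, (\int[mu]_v (K (v, e))%:E)%E = c%:E} ->
  {ae mu, forall v, (0 < delta v < +oo)%E} ->
  (\int[rho]_p (`|phi (fine (delta p.1))| * `|K p| * `|wt p.2|)%:E < +oo)%E ->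
  twice_continuously_differentiable `]0, +oo[%classic f ->
  0 < m -> m < M ->
  {ae mu, forall v, (m%:E <= delta v <= M%:E)%E} ->
  0 < alpha ->
  (forall t : R, m <= t <= M -> alpha <= (f^`(2))%classic t) ->
  (c * phi dbar + alpha / (2 * s) * \int[mu]_v (fine (delta v) - dbar) ^+ 2
     <= s^-1 * \int[rho]_p (phi (fine (delta p.1)) * K p * wt p.2))
  /\
  (s^-1 * \int[rho]_p (phi (fine (delta p.1)) * K p * wt p.2) = c * phi dbar
     <-> {ae mu, forall v, delta v = dbar%:E}).
Proof.
move=> f s delta dbar rhoE mK mwt _ /andP[mu_gt0 mu_lty] /andP[s_gt0 s_lty] iKwt.
move=> Kc _ _ fC2 m_gt0 mM deltamM alpha_gt0 f''_ge.
have wt_fin : (\int[tau]_e (wt e)%:E)%E \is a fin_num by rewrite gt0_fin_numE.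
have sE : (\int[tau]_e (wt e)%:E)%E = s%:E by rewrite fineK.
have s0 : 0 < s by rewrite fine_gt0// s_gt0.
have iwt : tau.-integrable setT (EFin \o wt).
  by apply: fin_num_integrable => //; exact/measurable_EFinP.
have [mD sD] := sigma_finite_neq0 iwt.
have smu : sigma_finite setT mu.
  by apply: fin_num_fun_sigma_finite; [rewrite measure0|exact: lty_fin_num_fun].
pose F p := (K p * wt p.2)%:E.
have mKwt : measurable_fun setT (fun p => K p * wt p.2).
  by apply: measurable_funM => //; exact: measurableT_comp.
have iF : rho.-integrable setT F.
  apply/integrableP; split; first exact/measurable_EFinP.
  by under eq_integral do rewrite /F/= normrM.
have F0 p : ~ [set e | wt e != 0] p.2 -> F p = 0%E.
  by move=> /negP; rewrite negbK => /eqP wt0; rewrite /F wt0 mulr0.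
have [ideltaF _ swapF] := fubini_sigma_finite_support rhoE smu mD sD F0 iF.
have mdelta : measurable_fun setT delta := measurable_int _ ideltaF.
have mFv v : measurable_fun setT (fun e => F (v, e)).
  apply: (measurableT_comp (f := F)); first exact/measurable_EFinP.
  exact: pair1_measurable.
pose Y v := Num.max m (Num.min M (fine (delta v))).
have mY : measurable_fun setT Y.
  apply: measurable_maxr => //; apply: measurable_minr => //.
  exact: measurableT_comp.
have YmM v : m <= Y v <= M.
  by rewrite /Y le_max lexx/= ge_max (ltW mM) ge_min lexx.
(* [phi] is only controlled where [delta v] lies in [m, M], hence the passage to
   the truncation [Y], and the need for [ae_eq_integralT]: [phi (fine (delta v))]
   may fail to be measurable on a null set. *)
have deltaY : {ae mu, forall v, delta v = (Y v)%:E}.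
  apply: filterS deltamM => v; rewrite /Y; case: (delta v) => [r| |]/=.
  - by rewrite !lee_fin => /andP[mr rM]; rewrite min_r// max_r.
  - by rewrite leye_eq andbF.
  - by [].
have meanY : \int[mu]_v fine (delta v) = \int[mu]_v Y v.
  by apply: ae_eq_Rintegral; apply: filterS deltaY => v ->.
have ffd t : m <= t <= M ->
    [/\ derivable f t 1, derivable (f^`())%classic t 1 & alpha <= (f^`(2))%classic t].
  move=> tmM; have /fC2[? ? _] : `]0, +oo[%classic t.
    by rewrite /= in_itv/= andbT; lra.
  by split => //; exact: f''_ge.
(* Away from 0, [phi x] is [x^-1 * f x], so it inherits continuity from the differentiable [f].
   Measurability and a uniform bound for [phi \o Y] follow. *)
have cphi : {within `[m, M], continuous phi}.
  apply/continuous_in_subspaceT => t /set_mem/=; rewrite in_itv/= => tmM.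
  have t0 : t != 0 by rewrite gt_eqF//; lra.
  have cf : (x^-1 * f x) @[x --> (t : R)] --> t^-1 * f t.
    apply: cvgM; first exact: cvgV.
    apply: differentiable_continuous; apply/derivable1_diffP.
    by have [] := ffd _ tmM.
  rewrite /continuous_at -[phi t]mul1r -(mulVf t0) -mulrA.
  have nt0 : \forall x \near (t : R), x != 0.
    by apply: (open_nbhs_nbhs (A := [set x | x != 0])); split => //; exact: open_neq.
  apply: cvg_trans cf; apply: near_eq_cvg; apply: filterS nt0 => x x0.
  by rewrite mulrA mulVf ?mul1r.
have mphi : measurable_fun setT (phi \o Y).
  apply: (@measurable_comp _ _ _ _ _ _ `[m, M]) => //.
  - by move=> _ [v _ <-]; rewrite /= in_itv/= YmM.
  - by apply: subspace_continuous_measurable_fun => //.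
have [C phiC] : exists C, forall v, `|phi (Y v)| <= C.
  have [|t _ tmax] := @EVT_max _ (fun t => `|phi t|) m M (ltW mM).
    by move=> x; apply: continuous_comp; [exact: cphi|exact: norm_continuous].
  by exists `|phi t| => v; apply: tmax; rewrite in_itv/= YmM.
(* [G] is the integrand with [Y] in place of [delta] inside [phi]; it is dominated by [C] times [F],
   hence integrable. *)
pose G p := (phi (Y p.1) * (K p * wt p.2))%:E.
have iG : rho.-integrable setT G.
  have := integrableZl measurableT C iF; apply: le_integrable => //.
    apply/measurable_EFinP; apply: measurable_funM => //.
    exact: (measurableT_comp mphi).
  move=> p _ /=; rewrite lee_fin !normrM; apply: ler_wpM2r; rewrite ?mulr_ge0//.
  exact: le_trans (phiC _) (ler_norm _).
have G0 p : ~ [set e | wt e != 0] p.2 -> G p = 0%E.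
  by move=> /negP; rewrite negbK => /eqP wt0; rewrite /G wt0 !mulr0.
have [_ fubG _] := fubini_sigma_finite_support rhoE smu mD sD G0 iG.
(* After Fubini, [phi (Y v)] leaves the inner integral, and what remains is [delta v], almost
   everywhere equal to [Y v]; the product is [f (Y v)]. *)
have fY : \int[rho]_p (phi (fine (delta p.1)) * K p * wt p.2) = \int[mu]_v f (Y v).
  rewrite /Rintegral; congr fine.
  transitivity (\int[rho]_p G p)%E.
    apply: ae_eq_integralT; apply: filterS (ae_fst_product rhoE deltaY) => p pY.
    by rewrite /G pY/= mulrA.
  rewrite fubG; apply: ae_eq_integralT; apply: filterS deltaY => v vY.
  rewrite /f mulrC EFinM -vY; under eq_integral do rewrite /G/= EFinM.
  rewrite integralZl//; apply: fin_num_integrable; first exact: mFv.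
  by rewrite (vY : (\int[tau]_e (K (v, e) * wt e)%:E)%E = _).
(* Integrating over [V] first turns [K (v, e) * wt e] into [c * wt e] for almost all [e]. *)
have cs : \int[mu]_v Y v = c * s.
  rewrite /Rintegral -[RHS]/(fine (c * s)%:E); congr fine.
  transitivity (\int[mu]_v delta v)%E.
    by apply: ae_eq_integralT; apply: filterS deltaY => v ->.
  rewrite swapF EFinM -sE -integralZl//.
  apply: ae_eq_integralT; apply: filterS Kc => e eK.
  rewrite -eK muleC; under eq_integral do rewrite /F/= EFinM muleC.
  rewrite integralZl//; apply: fin_num_integrable; last by rewrite eK.
  by apply/measurable_EFinP; apply: (measurableT_comp mK); exact: pair2_measurable.
have dbarE : dbar = (fine (mu [set: V]))^-1 * \int[mu]_v Y v by rewrite /dbar meanY.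
have S0 : 0 < fine (mu [set: V]) by rewrite fine_gt0// mu_gt0.
have dmM : m <= dbar <= M by rewrite dbarE; exact: mean_itv.
(* The total mass times [dbar] is [c * s], which converts the leading term of Jensen's inequality
   into that of the claim. *)
have SdE : fine (mu [set: V]) * f dbar = s * (c * phi dbar).
  have Sd : fine (mu [set: V]) * dbar = c * s.
    by rewrite dbarE mulrA mulfV ?gt_eqF// mul1r cs.
  by rewrite [RHS]mulrA [s * c]mulrC -Sd -mulrA.
have mfY : measurable_fun setT (f \o Y) by exact: measurable_funM.
have ifY : mu.-integrable setT (EFin \o (f \o Y)).
  apply: (integrable_bounded (C := M * C)) => // v.
  have /andP[mYv YvM] := YmM v.
  rewrite /= /f normrM ler_pM// ger0_norm//; lra.
have ineq : s * (c * phi dbar) + alpha / 2 * \int[mu]_v (Y v - dbar) ^+ 2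
    <= \int[mu]_v f (Y v).
  rewrite -SdE dbarE.
  apply: (jensen_quadratic _ _ mY YmM (b := (f^`())%classic dbar)) => //.
  by rewrite -dbarE => t tmM; exact: quadratic_lower_bound ffd dmM tmM.
have varE : \int[mu]_v (fine (delta v) - dbar) ^+ 2 = \int[mu]_v (Y v - dbar) ^+ 2.
  by apply: ae_eq_Rintegral; apply: filterS deltaY => v ->.
rewrite fY varE; split.
  rewrite -(ler_pM2l s0) mulrA mulfV ?gt_eqF// mul1r; apply: le_trans ineq.
  by rewrite le_eqVlt; apply/orP; left; apply/eqP; field; rewrite gt_eqF.
(* Equality leaves [alpha / 2] times the integral of the squared deviation at most 0, so [Y] is
   almost everywhere its mean. Conversely, a constant [delta] makes the integrand the constant
   [f dbar], and [SdE] evaluates its integral. *)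
split=> [eq|dE].
  have var0 : \int[mu]_v (Y v - dbar) ^+ 2 <= 0.
    move: ineq; rewrite -eq mulrA mulfV ?gt_eqF// mul1r gerDl pmulr_rle0//.
    by rewrite divr_gt0.
  have Yd : {ae mu, forall v, Y v = dbar}.
    by rewrite dbarE; apply: ae_eq_mean; rewrite -?dbarE.
  by apply: filterS2 deltaY Yd => v -> ->.
rewrite (_ : \int[mu]_v f (Y v) = \int[mu]_v cst (f dbar) v); last first.
  by apply: ae_eq_Rintegral; apply: filterS2 deltaY dE => v -> [->].
by rewrite Rintegral_cst// [f dbar * _]mulrC SdE mulKf// gt_eqF.
Qed.
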